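(* Let $X$ be a real Hilbert space. Let $T\colon X\to X$ be nonexpansive, let $(z_n)_{n\in\mathbb{N}}$ be a sequence in $X$ such that $z_n\rightharpoonup z\in X$, suppose that $Tz_n\rightharpoonup y\in X$, and that $C$ and $D$ are closed affine subspaces of $X$ such that $D-D=(C-C)^\perp$, $z_n+Tz_n-P_Cz_n-P_CTz_n\to 0$, and $z_n-Tz_n-P_Dz_n-P_D(-Tz_n)\to 0$. Then $\tfrac12 z+\tfrac12 y\in C$, $\tfrac12 z-\tfrac12 y\in D$, and $y=Tz$.
   Context: $X$ is a real Hilbert space with inner product $\langle\cdot,\cdot\rangle$ and induced norm $\|\cdot\|$. $\rightharpoonup$ denotes weak convergence and $\to$ denotes norm (strong) convergence. A mapping $T\colon X\to X$ is nonexpansive if $\|Tx-Ty\|\le\|x-y\|$ for all $x,y\in X$. Affine subspaces are understood to be nonempty. For an affine subspace $C$, $C-C=\{c-c'\mid c,c'\in C\}$ is the linear subspace parallel to $C$, and $\perp$ denotes orthogonal complement. For a nonempty closed convex set $S\subseteq X$, $P_S$ is the projector (nearest point mapping) onto $S$. *)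

(* Defs.v *)
From HB Require Import structures.
From mathcomp Require Import all_boot all_order all_algebra.
From mathcomp Require Import all_classical all_reals all_analysis.

Set Implicit Arguments.
Unset Strict Implicit.
Unset Printing Implicit Defensive.

Import Order.TTheory GRing.Theory Num.Theory.
Import numFieldNormedType.Exports.

Local Open Scope classical_set_scope.
Local Open Scope ring_scope.

(* A real Hilbert space is given by a complete normed module X together with  *)
(* a positive definite symmetric bilinear form ip : {dot X for idfun} such    *)
(* that induces_norm ip holds.                                                *)
Definition induces_norm (R : realType) (X : normedModType R)
    (ip : {dot X for idfun}) : Prop :=
  forall x : X, `|x| = Num.sqrt (ip x x).

Definition nonexpansive (R : realType) (X : normedModType R)
    (T : X -> X) : Prop :=
  forall x y : X, `|T x - T y| <= `|x - y|.

(* For a sequence, convergence in the coarsest topology that makes all the    *)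
(* functionals ip ^~ v continuous.                                            *)
Definition weakly_cvg (R : realType) (X : normedModType R)
    (ip : {dot X for idfun}) (u : nat -> X) (l : X) : Prop :=
  forall v : X, ip (u n) v @[n --> \oo] --> (ip l v : R).

Definition affine_subspace (R : realType) (X : lmodType R)
    (C : set X) : Prop :=
  C !=set0 /\
  forall (x y : X) (t : R), C x -> C y -> C (t *: x + (1 - t) *: y).

Definition set_sub (X : zmodType) (A B : set X) : set X :=
  [set x - y | x in A & y in B].

Definition orthocomplement (R : realType) (X : lmodType R)
    (ip : {dot X for idfun}) (A : set X) : set X :=
  [set x | forall y, A y -> ip x y = 0].

Definition nearest_point (R : realType) (X : normedModType R)
    (S : set X) (x p : X) : Prop :=
  S p /\ forall q, S q -> `|x - p| <= `|x - q|.

(* get picks a witness when one exists and is an arbitrary default otherwise; *)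
(* for S nonempty, closed and convex in a Hilbert space the nearest point     *)
(* exists and is unique, so the default is never used.                        *)
Definition projector (R : realType) (X : normedModType R)
    (S : set X) (x : X) : X :=
  get (nearest_point S x).

(* Main.v *)
(* Write U = C - C and V = D - D = U^⊥, and center a_n = z_n - z,
   b_n = T z_n - y.  Projecting onto an affine subspace gives residuals
   orthogonal to its direction, so passing to the weak limit puts the midpoints
   (z + y)/2 in C and (z - y)/2 in D.  Hence, up to the null residuals e_n and
   f_n of the two hypotheses, a_n + b_n lies in U and a_n - b_n lies in V; as weakly convergent
   sequences are bounded, |a_n|^2 - |b_n|^2 = <a_n - b_n, a_n + b_n> tends to 0.
   Expanding |T z_n - T z|^2 = |b_n + (y - T z)|^2 <= |a_n|^2 and using that b_n
   is weakly null yields |y - T z|^2 <= 0. *)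
Require Import Defs.
From HB Require Import structures.
From mathcomp Require Import all_boot all_order all_algebra.
From mathcomp Require Import all_classical all_reals all_analysis.
From mathcomp Require Import ring lra.

Set Implicit Arguments.
Unset Strict Implicit.
Unset Printing Implicit Defensive.

Import Order.TTheory GRing.Theory Num.Theory.
Import numFieldNormedType.Exports.

Local Open Scope classical_set_scope.
Local Open Scope ring_scope.

(** * Inner product identities, Cauchy-Schwarz and boundedness *)

Lemma dotC (R : realType) (X : lmodType R) (ip : {dot X for idfun}) (x y : X) :
  ip x y = ip y x.
Proof. by rewrite hermC expr0 mul1r. Qed.

Definition dot_linE (R : realType) (X : lmodType R) (ip : {dot X for idfun}) :=
  (@linearDl _ _ _ _ _ _ ip, @linearNl _ _ _ _ _ _ ip,
   @linearZl_LR _ _ _ _ _ _ ip, @linear0l _ _ _ _ _ _ ip,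
   @linearDr _ _ _ _ _ _ ip, @linearNr _ _ _ _ _ _ ip,
   @linearZr_LR _ _ _ _ _ _ ip, @linear0r _ _ _ _ _ _ ip).

Lemma dot_sqr_norm (R : realType) (X : normedModType R) (ip : {dot X for idfun})
    (ip_norm : induces_norm ip) (x : X) : ip x x = `|x| ^+ 2.
Proof.
rewrite ip_norm sqr_sqrtr//.
have [->|x0] := eqVneq x 0; first by rewrite dot_linE.
exact/ltW/neq0_dnorm_gt0.
Qed.

Lemma sqr_normB (R : realType) (X : normedModType R) (ip : {dot X for idfun})
    (ip_norm : induces_norm ip) (x y : X) :
  `|x - y| ^+ 2 = `|x| ^+ 2 - 2 * ip x y + `|y| ^+ 2.
Proof.
rewrite -!(dot_sqr_norm ip_norm) !dot_linE/= (dotC ip y x); ring.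
Qed.

(** Stated with the half-sum because for [x - q] and [x - q'] it is [x] minus the midpoint of [q]
    and [q']. *)
Lemma parallelogram (R : realType) (X : normedModType R) (ip : {dot X for idfun})
    (ip_norm : induces_norm ip) (x y : X) :
  `|x - y| ^+ 2 + 4 * `|2^-1 *: (x + y)| ^+ 2
  = 2 * `|x| ^+ 2 + 2 * `|y| ^+ 2.
Proof.
by rewrite -!(dot_sqr_norm ip_norm) !dot_linE/= (dotC ip y x); field.
Qed.

(** Cauchy-Schwarz: the residual of [x] after projection onto the line of [y] has nonnegative
    squared norm; multiplying by [|y| ^+ 2] clears the denominator. *)
Lemma ler_dot_norm (R : realType) (X : normedModType R) (ip : {dot X for idfun})
    (ip_norm : induces_norm ip) (x y : X) : `|ip x y| <= `|x| * `|y|.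
Proof.
have [->|y0] := eqVneq y 0; first by rewrite dot_linE !normr0 mulr0.
have y2_gt0 : 0 < `|y| ^+ 2 by rewrite exprn_gt0// normr_gt0.
rewrite -ler_sqr ?nnegrE ?mulr_ge0//.
rewrite -normrX ger0_norm ?sqr_ge0// exprMn.
suff: 0 <= `|x - (ip x y / `|y| ^+ 2) *: y| ^+ 2 * `|y| ^+ 2.
rewrite (sqr_normB ip_norm) !dot_linE/= normrZ exprMn -normrX.
rewrite (ger0_norm (sqr_ge0 (_ / _))).
set c := ip x y; set b := `|y| ^+ 2 in y2_gt0 *.
have -> : (`|x| ^+ 2 - 2 * (c / b * c) + (c / b) ^+ 2 * b) * b
    = `|x| ^+ 2 * b - c ^+ 2 by field; rewrite gt_eqF.
by rewrite subr_ge0.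
by rewrite mulr_ge0 ?sqr_ge0.
Qed.

Lemma cvg_dot0 (R : realType) (X : normedModType R) (ip : {dot X for idfun})
    (ip_norm : induces_norm ip) (u v : nat -> X) (M : R) :
  u n @[n --> \oo] --> (0 : X) -> (forall n, `|v n| <= M) ->
  ip (u n) (v n) @[n --> \oo] --> (0 : R).
Proof.
move=> u0 vM; apply/norm_cvg0P.
have uM0 : `|u n| * M @[n --> \oo] --> (0 : R).
  by rewrite -[0](mul0r M); apply: cvgMl; rewrite -(normr0 X); exact: cvg_norm.
apply: (squeeze_cvgr _ (cvg_cst 0) uM0); near=> n.
by rewrite normr_ge0 (le_trans (ler_dot_norm ip_norm _ _))// ler_wpM2l.
Unshelve. all: by end_near. Qed.

(** Uniform boundedness principle: the functionals [ip (u n)] converge pointwise, hence are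
    pointwise bounded, so they are uniformly bounded on the unit ball. Evaluating at the normalized
    [u n] recovers [|u n|]. *)
Lemma weakly_cvg_bounded (R : realType) (X : completeNormedModType R)
    (ip : {dot X for idfun}) (ip_norm : induces_norm ip)
    (u : nat -> X) (l : X) :
  weakly_cvg ip u l -> exists M, forall n, `|u n| <= M.
Proof.
move=> ul.
pose F : set (X -> R) := range (fun n => ip (u n) : X -> R).
have F_bnd : pointwise_bounded F.
  move=> x.
  have /cvg_seq_bounded : cvgn (fun n => ip (u n) x : R).
    by apply/cvg_ex; exists (ip l x); exact: ul.
  move=> /ex_strict_bound_gt0[M _ uM]; exists M => _ [n _ <-].
  exact/ltW/uM.
have F_lin f : F f -> bounded_fun_norm f /\ linear f.
  move=> [n _ <-]; split => [r|a x y]; last exact: linearPr.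
  exists (`|u n| * r) => x xr.
  by rewrite (le_trans (ler_dot_norm ip_norm _ _))// ler_wpM2l.
have [M uM] := Banach_Steinhauss F_lin F_bnd 1.
exists `|M| => n; have [->|un0] := eqVneq (u n) 0; first by rewrite normr0.
have un_neq0 : `|u n| != 0 by rewrite normr_eq0.
have := uM _ (imageT _ n) (`|u n|^-1 *: u n).
rewrite normrZ normfV normr_id mulVf// => /(_ (lexx _)).
rewrite !dot_linE/= (dot_sqr_norm ip_norm) expr2 mulKf// normr_id.
by move/le_trans; apply; exact: ler_norm.
Qed.

(** * Nearest points in closed affine subspaces *)

(** A minimizing sequence is Cauchy by the parallelogram law; completeness gives a limit, which lies
    in [S] by closedness and attains the infimum by continuity of the norm. *)
Lemma nearest_point_exists (R : realType) (X : completeNormedModType R)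
    (ip : {dot X for idfun}) (ip_norm : induces_norm ip) (S : set X) (x : X) :
  affine_subspace S -> closed S -> exists p, nearest_point S x p.
Proof.
move=> [[s0 Ss0] S_affine] S_closed.
pose E : set R := [set `|x - q| ^+ 2 | q in S].
have E_lb : lbound E 0 by move=> _ [q _ <-]; exact: sqr_ge0.
have E_inf : has_inf E by split; [exists (`|x - s0| ^+ 2), s0|exists 0].
have leE q : S q -> inf E <= `|x - q| ^+ 2.
  by move=> Sq; apply: (ge_inf E_inf.2); exists q.
have /choice[q_ qP] (n : nat) :
    exists q, S q /\ `|x - q| ^+ 2 < inf E + n.+1%:R^-1.
  have n_gt0 : (0 : R) < n.+1%:R^-1 by rewrite invr_gt0.
  by have [_ [q Sq <-] ltq] := inf_adherent n_gt0 E_inf; exists q.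
have q_close n m : `|q_ n - q_ m| ^+ 2 < 2 * n.+1%:R^-1 + 2 * m.+1%:R^-1.
  have [Sn ltn] := qP n; have [Sm ltm] := qP m.
  (* The midpoint of [q_ n] and [q_ m] stays in [S], so its squared distance to [x] is at least
     [inf E]. *)
  have := S_affine _ _ 2^-1 Sn Sm; rewrite [1 - _](_ : _ = 2^-1); last by field.
  move=> /leE; have := parallelogram ip_norm (x - q_ m) (x - q_ n).
  rewrite [x - q_ m - _](_ : _ = q_ n - q_ m); last first.
    by rewrite opprB addrC addrA subrK.
  rewrite [2^-1 *: _](_ : _ = x - (2^-1 *: q_ n + 2^-1 *: q_ m)); last first.
    rewrite addrACA -opprD scalerBr scalerDr -mulr2n -scaler_nat scalerA.
    by rewrite divff// scale1r scalerDr [2^-1 *: q_ m + _]addrC.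
  have arith (a b c d e f g : R) : a < g + e -> b < g + f ->
      c + 4 * d = 2 * b + 2 * a -> g <= d -> c < 2 * e + 2 * f by lra.
  exact: arith.
have /cauchy_cvg q_cvg : cauchy (q_ @ \oo).
  apply: cauchy_exP => e e_gt0.
  (* The quarter is chosen so that the two terms of [q_close] add up to [e ^+ 2]. *)
  have e2_gt0 : 0 < e ^+ 2 / 4 by rewrite divr_gt0// exprn_gt0.
  have [N _ ltN] := near_infty_natSinv_lt (PosNum e2_gt0).
  exists (q_ N); exists N => //= n /= leNn; rewrite -ball_normE/=.
  rewrite -ltr_sqr ?nnegrE// ?(ltW e_gt0)//.
  have := q_close N n; have /= := ltN _ leNn; have /= := ltN _ (leqnn N).
  have arith (a b c d : R) : a < d / 4 -> b < d / 4 -> c < 2 * a + 2 * b ->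
      c < d by lra.
  exact: arith.
have {q_cvg} q_cvg : q_ n @[n --> \oo] --> lim (q_ @ \oo) by [].
set p := lim _ in q_cvg.
have Sp : S p by apply: (closed_cvg S S_closed _ _ q_cvg); near=> n; case: (qP n).
exists p; split => // q Sq; rewrite -ler_sqr ?nnegrE//.
apply: le_trans (leE q Sq).
have qp : `|x - q_ n| @[n --> \oo] --> `|x - p|.
  by apply: cvg_norm; apply: cvgB => //; exact: cvg_cst.
have infE : inf E + n.+1%:R^-1 @[n --> \oo] --> inf E.
  by rewrite -[X in _ --> X]addr0; apply: cvgD; [exact: cvg_cst|exact: cvg_harmonic].
apply: (ler_cvg_to (cvgM qp qp) infE); near=> n; exact/ltW/(qP n).2.
Unshelve. all: by end_near. Qed.

Lemma projectorP (R : realType) (X : completeNormedModType R)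
    (ip : {dot X for idfun}) (ip_norm : induces_norm ip) (S : set X) (x : X) :
  affine_subspace S -> closed S -> nearest_point S x (projector S x).
Proof. by move=> S_affine /(nearest_point_exists ip_norm x S_affine)/getPex. Qed.

(** First-order optimality: the whole line through [p] and [q] lies in [S], and a nonzero inner
    product would allow a move along it that comes closer to [x]. *)
Lemma nearest_point_ortho (R : realType) (X : normedModType R)
    (ip : {dot X for idfun}) (ip_norm : induces_norm ip) (S : set X)
    (x p q : X) :
  affine_subspace S -> nearest_point S x p -> S q -> ip (q - p) (x - p) = 0.
Proof.
move=> [_ S_affine] [Sp p_min] Sq.
have [->|qp] := eqVneq (q - p) 0; first by rewrite dot_linE.
set b := `|q - p| ^+ 2; set c := ip (q - p) (x - p).
have b_gt0 : 0 < b by rewrite exprn_gt0// normr_gt0.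
(* The weight [c / b] minimizes the distance to [x] along this line; it lowers the squared distance
   by [c ^+ 2 / b], which must therefore vanish. *)
have := p_min _ (S_affine _ _ (c / b) Sq Sp).
rewrite -ler_sqr ?nnegrE// [x - (_ + _)](_ : _ = (x - p) - (c / b) *: (q - p)).
  rewrite (sqr_normB ip_norm (x - p)) linearZr_LR/= (dotC ip (x - p)) -/c.
  rewrite normrZ exprMn -normrX (ger0_norm (sqr_ge0 (_ / _))) -/b.
  have -> : (c / b) ^+ 2 * b = c ^+ 2 / b by field; rewrite gt_eqF.
  have -> : c / b * c = c ^+ 2 / b by field; rewrite gt_eqF.
  have : 0 <= c ^+ 2 / b by rewrite divr_ge0 ?sqr_ge0// ltW.
  move=> h1 h2; have /eqP : c ^+ 2 / b = 0 by lra.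
  by rewrite mulf_eq0 invr_eq0 (gt_eqF b_gt0) orbF sqrf_eq0 => /eqP.
rewrite scalerBl scale1r scalerBr !opprD !opprK addrA.
by rewrite [RHS]addrAC addrA [RHS]addrAC -!addrA; congr (_ + _); rewrite addrCA.
Qed.

Lemma projector_ortho (R : realType) (X : completeNormedModType R)
    (ip : {dot X for idfun}) (ip_norm : induces_norm ip) (S : set X)
    (x q : X) :
  affine_subspace S -> closed S -> S q ->
  ip (q - projector S x) (x - projector S x) = 0.
Proof.
move=> S_affine S_closed; apply: nearest_point_ortho => //.
exact: (projectorP ip_norm).
Qed.

(** * Weak limits, and midpoints of weak limits in closed affine subspaces *)

Lemma cvg_weakly (R : realType) (X : normedModType R)
    (ip : {dot X for idfun}) (ip_norm : induces_norm ip) (u : nat -> X) :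
  u n @[n --> \oo] --> (0 : X) -> weakly_cvg ip u 0.
Proof.
move=> u0 v; rewrite linear0l.
exact: (cvg_dot0 ip_norm u0 (fun=> lexx `|v|)).
Qed.

Lemma weakly_cvgN (R : realType) (X : normedModType R)
    (ip : {dot X for idfun}) (u : nat -> X) (l : X) :
  weakly_cvg ip u l -> weakly_cvg ip (fun n => - u n) (- l).
Proof.
move=> ul v; under eq_fun do rewrite linearNl.
by rewrite linearNl; apply: cvgN; exact: ul.
Qed.

Lemma weakly_cvgD (R : realType) (X : normedModType R)
    (ip : {dot X for idfun}) (u v : nat -> X) (l m : X) :
  weakly_cvg ip u l -> weakly_cvg ip v m ->
  weakly_cvg ip (fun n => u n + v n) (l + m).
Proof.
move=> ul vm w; under eq_fun do rewrite linearDl.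
by rewrite linearDl; apply: cvgD; [exact: ul|exact: vm].
Qed.

Lemma weakly_cvgB (R : realType) (X : normedModType R)
    (ip : {dot X for idfun}) (u v : nat -> X) (l m : X) :
  weakly_cvg ip u l -> weakly_cvg ip v m ->
  weakly_cvg ip (fun n => u n - v n) (l - m).
Proof. by move=> ul vm; exact: weakly_cvgD ul (weakly_cvgN vm). Qed.

Lemma weakly_cvg_sub0 (R : realType) (X : normedModType R)
    (ip : {dot X for idfun}) (u : nat -> X) (l : X) :
  weakly_cvg ip u l -> weakly_cvg ip (fun n => u n - l) 0.
Proof.
move=> ul; rewrite -(subrr l); apply: weakly_cvgB ul _ => v.
exact: cvg_cst.
Qed.

(* With [m] the midpoint of the weak limits and [w = m - P_S m], which is
   orthogonal to [S - S], pairing the residuals with [w] yields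
   [<m, w> = <P_S m, w>], i.e. [w = 0]. *)
Lemma weak_midpoint_mem (R : realType) (X : completeNormedModType R)
    (ip : {dot X for idfun}) (ip_norm : induces_norm ip) (S : set X)
    (s t : nat -> X) (s0 t0 : X) :
  affine_subspace S -> closed S ->
  weakly_cvg ip s s0 -> weakly_cvg ip t t0 ->
  s n + t n - projector S (s n) - projector S (t n) @[n --> \oo] --> (0 : X) ->
  S (2^-1 *: s0 + 2^-1 *: t0).
Proof.
move=> S_affine S_closed ss0 tt0 res0.
have PS x : S (projector S x).
  by have [] := projectorP ip_norm x S_affine S_closed.
set m := _ + _; set p := projector S m; set w := m - p.
suff /eqP : ip w w = 0.
  rewrite (dot_sqr_norm ip_norm) sqrf_eq0 normr_eq0 subr_eq0 => /eqP ->.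
  exact: PS.
have ortho x : ip (projector S x) w = ip p w.
  have /eqP := projector_ortho ip_norm m S_affine S_closed (PS x).
  by rewrite linearBl subr_eq0 => /eqP.
have /(_ w) lim := weakly_cvgB (weakly_cvgD ss0 tt0) (cvg_weakly ip_norm res0).
have eq n : ip (s n + t n - (s n + t n - projector S (s n) - projector S (t n)))
    w = 2 * ip p w.
  by rewrite !(linearDl, linearNl)/= !ortho; ring.
move: lim; under eq_fun do rewrite eq.
(* The paired sequence is constant by [eq], so uniqueness of limits equates [2 * ip p w] with
   [ip (s0 + t0 - 0) w], that is [2 * ip m w]. *)
move=> /(cvg_unique (@norm_hausdorff _ _) (cvg_cst (2 * ip p w))).
rewrite {2}/w linearBr /= !(dotC ip w) /m !dot_linE/=; lra.
Qed.

Theorem corollary2p5 (R : realType) (X : completeNormedModType R)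
    (ip : {dot X for idfun}) (ip_norm : induces_norm ip)
    (T : X -> X) (T_nonexp : nonexpansive T)
    (z_ : nat -> X) (z y : X) (C D : set X) :
  weakly_cvg ip z_ z ->
  weakly_cvg ip (fun n => T (z_ n)) y ->
  affine_subspace C -> closed C ->
  affine_subspace D -> closed D ->
  set_sub D D = orthocomplement ip (set_sub C C) ->
  z_ n + T (z_ n) - projector C (z_ n) - projector C (T (z_ n))
    @[n --> \oo] --> (0 : X) ->
  z_ n - T (z_ n) - projector D (z_ n) - projector D (- T (z_ n))
    @[n --> \oo] --> (0 : X) ->
  [/\ C (2^-1 *: z + 2^-1 *: y),
      D (2^-1 *: z - 2^-1 *: y) &
      y = T z].
Proof.
move=> zz Ty C_affine C_closed D_affine D_closed DC resC resD.
have Tyn := weakly_cvgN Ty.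
have Cm := weak_midpoint_mem ip_norm C_affine C_closed zz Ty resC.
have := weak_midpoint_mem ip_norm D_affine D_closed zz Tyn resD.
rewrite scalerN => Dm; split => //.
have half (x : X) : 2^-1 *: x + 2^-1 *: x = x.
  by rewrite -[RHS]scale1r [1 in RHS]splitr scalerDl div1r.
set c := _ + _ in Cm; set d := _ - _ in Dm.
have cc : c + c = z + y by rewrite /c addrACA !half.
have dd : d + d = z - y by rewrite /d addrACA -opprD !half.
have shift (s p q m : X) : s - m - (s - p - q) = p + q - m.
  by rewrite -[s - p - q]addrA -opprD opprB addrC addrA subrK.
pose a n := z_ n - z; pose b n := T (z_ n) - y.
set e := fun n => _ - _ in resC; set f := fun n => _ - _ in resD.
have a0 : weakly_cvg ip a 0 := weakly_cvg_sub0 zz.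
have b0 : weakly_cvg ip b 0 := weakly_cvg_sub0 Ty.
(* Since [c + c = z + y], subtracting the residual leaves a sum of two differences of points of [C];
   [abf] is the analogue for [D]. *)
have abe n : a n + b n - e n
    = (projector C (z_ n) - c) + (projector C (T (z_ n)) - c).
  rewrite [RHS]addrACA -opprD cc -[RHS](shift (z_ n + T (z_ n))).
  by rewrite [- (z + y)]opprD [in RHS]addrACA.
have abf n : a n - b n - f n
    = (projector D (z_ n) - d) + (projector D (- T (z_ n)) - d).
  rewrite [RHS]addrACA -opprD dd -[RHS](shift (z_ n - T (z_ n))) [- (z - y)]opprD.
  by rewrite [in RHS]addrACA -[- T _ - _]opprD.
have ortho n : ip (a n - b n - f n) (a n + b n - e n) = 0.
  have PC x : C (projector C x).
    by have [] := projectorP ip_norm x C_affine C_closed.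
  have PD x : D (projector D x).
    by have [] := projectorP ip_norm x D_affine D_closed.
  have DCd x x' : ip (projector D x - d) (projector C x' - c) = 0.
    have : set_sub D D (projector D x - d) by exists (projector D x); last exists d.
    by rewrite DC; apply; exists (projector C x'); last exists c.
  have dot_add0 (u u' v v' : X) : ip u v = 0 -> ip u v' = 0 ->
      ip u' v = 0 -> ip u' v' = 0 -> ip (u + u') (v + v') = 0.
    by move=> uv uv' u'v u'v'; rewrite linearDl !linearDr/= uv uv' u'v u'v' !addr0.
  by rewrite abe abf dot_add0.
(* Each null residual will be paired with a bounded sequence: [f] with [a + b], and [e] with
   [a - b - f]. *)
have [M abM] := weakly_cvg_bounded ip_norm (weakly_cvgD a0 b0).
have [N abfN] := weakly_cvg_bounded ip_norm
  (weakly_cvgB (weakly_cvgB a0 b0) (cvg_weakly ip_norm resD)).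
(* This is [ortho] expanded, with [ip (a n - b n) (a n + b n)] written as a difference of
   squares. *)
have diff n : `|a n| ^+ 2 - `|b n| ^+ 2
    = ip (f n) (a n + b n) + ip (e n) (a n - b n - f n).
  move: (a n) (b n) (e n) (f n) (ortho n) => u v p q.
  rewrite -!(dot_sqr_norm ip_norm) (dotC ip p) !dot_linE/= (dotC ip v u); lra.
have lim0 : ip (f n) (a n + b n) + ip (e n) (a n - b n - f n)
    - 2 * ip (b n) (y - T z) @[n --> \oo] --> (0 : R).
  rewrite -[X in _ --> X](_ : 0 + 0 - 2 * ip 0 (y - T z) = 0); last first.
    by rewrite linear0l; ring.
  apply: cvgB; last exact: cvgMr.
  by apply: cvgD; [exact: cvg_dot0 abM|exact: cvg_dot0 abfN].
apply/eqP; rewrite -subr_eq0 -normr_eq0 -sqrf_eq0 eq_le sqr_ge0 andbT.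
(* The constant [|y - T z| ^+ 2] is bounded by every term of the null sequence in [lim0]: expand the
   square in the nonexpansiveness inequality at [z_ n] and [z], then substitute [diff]. *)
apply: (ler_cvg_to (cvg_cst _) lim0); near=> n.
have := T_nonexp (z_ n) z; rewrite -ler_sqr ?nnegrE// -diff.
rewrite -/(a n) [T (z_ n) - T z](_ : _ = b n - (T z - y)); last first.
  by rewrite /b opprB addrA subrK.
rewrite (sqr_normB ip_norm (b n)) -[y - T z]opprB linearNr normrN /=; lra.
Unshelve. all: by end_near. Qed.
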